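(* Let $S$ be a sample space consisting of $12$ equally likely outcomes, each of probability $1/12$. Let $K_1$ be the number of unordered pairs $\{A,B\}$ of independent events $A,B\subset S$ with $0<|A|<12$ and $0<|B|<12$. For such a pair, named so that $a=|A|\le b=|B|$, put $d=|A\cap B|$. Then the possible values of $(d;a,b)$, and for each of them the four sizes (as an unordered list) of the cells $A\cap B$, $A\cap B^{C}$, $A^{C}\cap B$, $A^{C}\cap B^{C}$, are exactly the following: (i) $(1;3,4)$, $(2;3,8)$, $(3;4,9)$, $(6;8,9)$, with cell sizes $[1,2,3,6]$, and each of these four cases contains exactly $n_1=55{,}440$ pairs; (ii) $(1;2,6)$, $(5;6,10)$, with cell sizes $[1,1,5,5]$, and each of these two cases contains exactly $n_2=33{,}264$ pairs; (iii) $(2;4,6)$, $(4;6,8)$, with cell sizes $[2,2,4,4]$, and each of these two cases contains exactly $n_3=207{,}900$ pairs; (iv) $(3;6,6)$, with cell sizes $[3,3,3,3]$, and this case contains exactly $n_4=184{,}800$ pairs. Consequently $K_1=4n_1+2n_2+2n_3+n_4=888{,}888$.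
   Context: Events are subsets of $S$, with $P(A)=|A|/12$ (this is the sample space of flipping a fair coin and then tossing a fair die). Two events $A,B$ are independent if $P(A\cap B)=P(A)P(B)$. $A^{C}$ denotes the complement of $A$ in $S$. Pairs are counted without regard to order, and the trivial events $\emptyset$ and $S$ are excluded. *)

(* Defs.v *)
From mathcomp Require Import all_boot all_order all_algebra.

Set Implicit Arguments.
Unset Strict Implicit.
Unset Printing Implicit Defensive.

(* Uniform probability: when #|T| = 12, this is P(A) = #|A| / 12. *)
Definition uprob (T : finType) (A : {set T}) : rat :=
  (#|A|%:R / #|T|%:R)%R.

Definition independent (T : finType) (A B : {set T}) : bool :=
  uprob (A :&: B) == (uprob A * uprob B)%R.

Definition nontrivial (T : finType) (A : {set T}) : bool := 0 < #|A| < #|T|.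

Definition indep_events (T : finType) (A B : {set T}) : bool :=
  [&& nontrivial A, nontrivial B & independent A B].

(* The unordered pair {A, B} is encoded as the set of events [set A; B]; so
   swapping A and B yields the same element.  The degenerate pair {A, A} is
   not excluded by fiat: a nontrivial A is never independent of itself. *)
Definition indep_pairs (T : finType) : {set {set {set T}}} :=
  [set [set A; B] | A in [set: {set T}], B in [set: {set T}] & indep_events A B].

(* (A, B), named so that #|A| <= #|B|, realizes the triple (d; a, b). *)
Definition has_type (T : finType) (d a b : nat) (A B : {set T}) : bool :=
  [&& indep_events A B, #|A| <= #|B|,
      #|A :&: B| == d, #|A| == a & #|B| == b].

Definition pairs_of_type (T : finType) (d a b : nat) : {set {set {set T}}} :=
  [set [set A; B] | A in [set: {set T}], B in [set: {set T}] & has_type d a b A B].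

(* To be compared up to permutation (perm_eq). *)
Definition cell_sizes (T : finType) (A B : {set T}) : seq nat :=
  [:: #|A :&: B|; #|A :&: ~: B|; #|~: A :&: B|; #|~: A :&: ~: B|].

(* Every triple (d; a, b) in the list ts is the type of exactly n unordered
   pairs, and all of these have the cell sizes cs. *)
Definition case_spec (T : finType) (ts : seq (nat * nat * nat))
    (cs : seq nat) (n : nat) : Prop :=
  forall d a b : nat, (d, a, b) \in ts ->
    #|pairs_of_type T d a b| = n /\
    (forall A B : {set T}, has_type d a b A B -> perm_eq (cell_sizes A B) cs).

(* Main.v *)
Require Import Defs.
From mathcomp Require Import all_boot all_order all_algebra.
From mathcomp Require Import zify.
From Stdlib Require PeanoNat.

Set Implicit Arguments.
Unset Strict Implicit.
Unset Printing Implicit Defensive.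

(** An event B is determined by its traces on A and on the complement of A, so
    'C(12, a) * 'C(a, d) * 'C(12 - a, b - d) ordered pairs realize (d; a, b).
    Independence of nontrivial events means 12 d = a b with 0 < a, b < 12, which
    leaves nine triples.  Passing to unordered pairs loses nothing when a < b
    and halves the count when a = b = 6; distinct triples are realized by
    disjoint sets of unordered pairs, so the counts add up to K_1. *)

Ltac eval_bins := repeat match goal with |- context ['C(?m, ?k)] =>
  let v := eval vm_compute in 'C(m, k) in change 'C(m, k) with v end.

(* Numerals above 5000 are parsed as Nat.of_num_uint applied to a list of
   digits; unfolding it to Horner form keeps them out of unary. *)
Ltac lia_num :=
  cbn [Nat.of_num_uint Nat.of_uint Nat.of_uint_acc];
  rewrite ?PeanoNat.Nat.tail_mul_spec; lia.

(** * Unordered pairs versus ordered pairs *)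

Lemma set2_inj {T : finType} {x y z t : T} :
  [set x; y] = [set z; t] -> (x = z /\ y = t) \/ (x = t /\ y = z).
Proof.
move=> e.
have := set21 x y; rewrite e => /set2P hx.
have := set22 x y; rewrite e => /set2P hy.
have := set21 z t; rewrite -e => /set2P hz.
have := set22 z t; rewrite -e => /set2P ht.
by case: hx hy hz ht => ? [] ? [] ? [] ?; subst; auto.
Qed.

(** As the image of a single map on ordered pairs, the family can be counted through the fibres of
    that map. *)
Lemma set2_imset (T : finType) (R : rel T) :
  [set [set x; y] | x in [set: T], y in [set: T] & R x y] =
  [set [set p.1; p.2] | p in [set p : T * T | R p.1 p.2]].
Proof.
apply/setP => P; apply/imset2P/imsetP => [[x y _]|[[x y]]].
  by rewrite !inE /= => Rxy ->; exists (x, y); rewrite ?inE.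
by rewrite inE /= => Rxy ->; exists x y; rewrite ?inE.
Qed.

(** By asymmetry only one ordering of an unordered pair can satisfy [R], so forgetting the order is
    injective on [R]. *)
Lemma card_set2_asym (T : finType) (R : rel T) :
  (forall x y, R x y -> ~~ R y x) ->
  #|[set [set x; y] | x in [set: T], y in [set: T] & R x y]| =
  #|[set p : T * T | R p.1 p.2]|.
Proof.
move=> asymR; rewrite set2_imset card_in_imset // => -[x y] [z t].
rewrite !inE /= => Rxy Rzt /set2_inj[[-> -> //]|[ex ey]].
by move: Rxy; rewrite ex ey (negPf (asymR _ _ Rzt)).
Qed.

(** Each fibre of the order-forgetting map consists of [(x, y)] and [(y, x)]: both lie in [R] by
    symmetry, and irreflexivity makes them distinct. *)
Lemma card_set2_sym (T : finType) (R : rel T) :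
  irreflexive R -> symmetric R ->
  2 * #|[set [set x; y] | x in [set: T], y in [set: T] & R x y]| =
  #|[set p : T * T | R p.1 p.2]|.
Proof.
move=> irrR symR; rewrite set2_imset; set O := [set p | _].
pose f (p : T * T) := [set p.1; p.2].
rewrite -[RHS]sum1_card (partition_big f (mem (f @: O))) /=; last first.
  by move=> p Op; apply: imset_f.
rewrite mulnC -sum_nat_const; apply: eq_bigr => P /imsetP[[x y]].
rewrite inE /= => Rxy ->.
rewrite sum1dep_card (_ : [set _ | _] = [set (x, y); (y, x)]); last first.
  apply/setP => -[z t]; rewrite !inE /=; apply/andP/orP.
    by case=> _ /eqP /set2_inj /= [] [-> ->]; rewrite eqxx; auto.
  case=> /eqP[-> ->]; rewrite /f /= ?(symR y) Rxy //.
  by rewrite setUC.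
rewrite cards2 (_ : (x, y) != (y, x)) //.
by apply: contraTneq Rxy => -[-> _]; rewrite irrR.
Qed.

(** * Counting events with prescribed intersection sizes *)

Lemma card_split_draws (T : finType) (A : {set T}) (d e : nat) :
  #|[set B : {set T} | (#|A :&: B| == d) && (#|B :\: A| == e)]| =
  'C(#|A|, d) * 'C(#|~: A|, e).
Proof.
rewrite -!cards_draws -cardsX.
rewrite -[RHS](@card_in_imset _ _ (fun p => p.1 :|: p.2)); last first.
  move=> [X Y] [X' Y']; rewrite !inE /= => /andP[/andP[sX _] /andP[sY _]].
  move=> /andP[/andP[sX' _] /andP[sY' _]] e0.
  (* The union map on pairs of traces is injective: intersecting with [A] and removing [A] recover
     the two components. *)
  have trace (Z W : {set T}) : Z \subset A -> W \subset ~: A ->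
      (Z :|: W) :&: A = Z /\ (Z :|: W) :\: A = W.
    move=> sZ sW; rewrite setIUl setDUl (setIidPl sZ).
    have /eqP-> : Z :\: A == set0 by rewrite setD_eq0.
    have /eqP-> : W :&: A == set0 by rewrite setI_eq0 disjoints_subset.
    by rewrite setU0 set0U setDE (setIidPl sW).
  have [tX tY] := trace _ _ sX sY; have [tX' tY'] := trace _ _ sX' sY'.
  by congr (_, _); [rewrite -tX e0 | rewrite -tY e0].
apply: eq_card => B; rewrite inE; apply/idP/imsetP => [hB|[[X Y]]].
  exists (A :&: B, B :\: A); last by rewrite /= setIC setID.
  by rewrite !inE /= subsetIl setDE subsetIr -setDE.
rewrite !inE /= => /andP[/andP[sX cX] /andP[sY cY]] ->.
rewrite setIUr setDUl (setIidPr sX).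
have /eqP-> : X :\: A == set0 by rewrite setD_eq0.
have /eqP-> : A :&: Y == set0 by rewrite setIC setI_eq0 disjoints_subset.
by rewrite setU0 set0U setDE (setIidPl sY) cX.
Qed.

(** Sum over the first event [A]: each [A] of size [a] contributes the same number of [B], and every
    other [A] contributes none. The bound on [d] keeps the truncated difference [b - d]
    meaningful. *)
Lemma card_pairs_of_sizes (T : finType) (d a b : nat) : d <= b ->
  #|[set p : {set T} * {set T} |
      [&& #|p.1 :&: p.2| == d, #|p.1| == a & #|p.2| == b]]| =
  'C(#|T|, a) * ('C(a, d) * 'C(#|T| - a, b - d)).
Proof.
move=> le_db; rewrite -{1}cardsT -(cards_draws [set: T]).
rewrite -sum_nat_const -sum1dep_card.
rewrite -(pair_big_dep predT (fun A B : {set T} =>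
  [&& #|A :&: B| == d, #|A| == a & #|B| == b]) (fun _ _ => 1)) /=.
rewrite [RHS]big_mkcond; apply: eq_bigr => A _; rewrite inE subsetT /=.
rewrite sum1dep_card; case: (eqVneq #|A| a) => [eA|_]; last first.
  by apply/eqP; rewrite cards_eq0 -subset0; apply/subsetP => B; rewrite !inE andbF.
rewrite -eA; have <- : #|~: A| = #|T| - #|A| by rewrite [LHS]cardsCs setCK.
rewrite -card_split_draws; apply: eq_card => B.
rewrite !inE /= -(cardsID A B) (setIC B).
(* Once the trace on [A] has size [d], having [b] elements in all amounts to having [b - d] outside
   [A]. *)
by case: eqP => //= ->; lia.
Qed.

(** * Disjoint unions over a list of types *)

Lemma bigcup_seqP (I : eqType) (T : finType) (F : I -> {set T}) (s : seq I) x :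
  reflect (exists2 i, i \in s & x \in F i) (x \in \bigcup_(i <- s) F i).
Proof.
elim: s => [|i s IHs]; first by rewrite big_nil inE; constructor=> -[].
rewrite big_cons inE; apply: (iffP orP) => [[Fi|/IHs[j js Fj]]|[j]].
- by exists i; rewrite ?mem_head.
- by exists j; rewrite // inE js orbT.
by rewrite inE => /orP[/eqP->|js Fj]; [left | right; apply/IHs; exists j].
Qed.

Lemma card_bigcup_seq (I : eqType) (T : finType) (F : I -> {set T}) (s : seq I) :
  (forall i j x, x \in F i -> x \in F j -> i = j) -> uniq s ->
  #|\bigcup_(i <- s) F i| = \sum_(i <- s) #|F i|.
Proof.
move=> disjF; elim: s => [|i s IHs]; first by rewrite !big_nil cards0.
rewrite !big_cons /= => /andP[i_s /IHs <-]; rewrite cardsU.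
rewrite (_ : _ :&: _ = set0) ?cards0 ?subn0 //.
apply/setP => x; rewrite !inE; apply/negP => /andP[Fi].
case/bigcup_seqP => j js Fj.
by rewrite (disjF _ _ _ Fi Fj) js in i_s.
Qed.

(** Two namings of one pair can differ only by a swap; as both are sorted by size, a swap forces
    equal sizes and leaves the triple unchanged. *)
Lemma pairs_of_type_inj (T : finType) (t t' : nat * nat * nat) P :
  P \in pairs_of_type T t.1.1 t.1.2 t.2 ->
  P \in pairs_of_type T t'.1.1 t'.1.2 t'.2 -> t = t'.
Proof.
case: t t' => [[d a] b] [[d' a'] b'] /=.
case/imset2P=> A B _; rewrite !inE /=.
move=> /and5P[_ le_ab /eqP <- /eqP <- /eqP <-] ->.
case/imset2P=> A' B' _; rewrite !inE /=.
move=> /and5P[_ le_ab' /eqP <- /eqP <- /eqP <-].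
case/set2_inj => -[eA eB]; rewrite -{}eA -{}eB // in le_ab' *.
have -> : #|A| = #|B| by lia.
by rewrite setIC.
Qed.

(** * Independence on twelve outcomes *)

Lemma independentE (T : finType) (A B : {set T}) : 0 < #|T| ->
  independent A B = (#|T| * #|A :&: B| == #|A| * #|B|).
Proof.
move=> T0; have nz : (#|T|%:R != 0 :> rat)%R by rewrite Num.Theory.pnatr_eq0 -lt0n.
rewrite /independent /uprob GRing.mulf_div.
rewrite GRing.eqr_div ?GRing.mulf_neq0 // -!GRing.natrM Num.Theory.eqr_nat.
rewrite mulnA (mulnC _ #|T|) (mulnC _ #|T|) [X in _ == X]mulnC.
by rewrite eqn_pmul2l // mulnC.
Qed.

Definition indep_types : seq (nat * nat * nat) :=
  [:: (1, 3, 4); (2, 3, 8); (3, 4, 9); (6, 8, 9); (1, 2, 6); (5, 6, 10);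
      (2, 4, 6); (4, 6, 8); (3, 6, 6)].

Lemma indep_typesP (S : finType) (hS : #|S| = 12) (A B : {set S}) :
  indep_events A B && (#|A| <= #|B|) =
  ((#|A :&: B|, #|A|, #|B|) \in indep_types).
Proof.
rewrite /indep_events /nontrivial independentE hS //.
apply/idP/idP => [|/[!inE]]; last first.
  by do 8?[case/orP]; move=> /eqP[-> -> ->].
rewrite -!andbA => /and5P[a0 a12 b0 b12 /andP[/eqP e le_ab]].
move: #|A| #|B| #|_ :&: _| a0 a12 b0 b12 e le_ab => a b d.
do 12?[case: a => [|a] //]; do 12?[case: b => [|b] //]; move=> _ _ _ _ e //.
(* Values [d >= 9] remain symbolic and are refuted by [lia]: the only products of two factors up to
   11 that reach 108 are 110 and 121, neither a multiple of 12. *)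
all: do 9?[case: d e => [|d] e //].
all: by move: e; lia.
Qed.

(** Independence, nontriviality and the ordering depend on the three sizes alone, so for a listed
    triple the count by sizes applies directly. *)
Lemma has_typeE (S : finType) (hS : #|S| = 12) (d a b : nat) (A B : {set S}) :
  has_type d a b A B =
  ((d, a, b) \in indep_types) &&
    [&& #|A :&: B| == d, #|A| == a & #|B| == b].
Proof.
rewrite /has_type andbA (indep_typesP hS) [RHS]andbC.
apply/andP/andP => [] [h1 h2]; split=> //.
  by case/and3P: h2 h1 => /eqP-> /eqP-> /eqP->.
by case/and3P: h1 h2 => /eqP-> /eqP-> /eqP->.
Qed.

Lemma card_has_type (S : finType) (hS : #|S| = 12) (d a b : nat) :
  (d, a, b) \in indep_types ->
  #|[set p : {set S} * {set S} | has_type d a b p.1 p.2]| =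
  'C(12, a) * ('C(a, d) * 'C(12 - a, b - d)).
Proof.
move=> dab; rewrite -hS -card_pairs_of_sizes; last first.
    by move: dab; rewrite !inE; do 8?[case/orP]; move=> /eqP[-> _ ->].
by apply: eq_card => p; rewrite !inE (has_typeE hS) dab.
Qed.

Lemma exists_has_type (S : finType) (hS : #|S| = 12) (d a b : nat) :
  (exists A B : {set S}, has_type d a b A B) <-> (d, a, b) \in indep_types.
Proof.
split=> [[A [B]]|dab]; first by rewrite (has_typeE hS) => /andP[].
suff /card_gt0P[[A B]] : 0 < #|[set p : {set S} * {set S} | has_type d a b p.1 p.2]|.
  by rewrite inE; exists A, B.
(* Existence follows from a positive count, without exhibiting events. *)
rewrite (card_has_type hS) // !muln_gt0 !bin_gt0.
by move: dab; rewrite !inE; do 8?[case/orP]; move=> /eqP[-> -> ->].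
Qed.

Lemma card_pairs_of_type_lt (S : finType) (hS : #|S| = 12) (d a b : nat) :
  (d, a, b) \in indep_types -> a < b ->
  #|pairs_of_type S d a b| = 'C(12, a) * ('C(a, d) * 'C(12 - a, b - d)).
Proof.
move=> dab lt_ab; rewrite -(card_has_type hS) // card_set2_asym // => A B.
rewrite !(has_typeE hS) => /andP[_ /and3P[_ /eqP eA /eqP eB]].
by apply/negP => /andP[_ /and3P[_ /eqP eB' _]]; lia.
Qed.

Lemma card_pairs_of_type_eq (S : finType) (hS : #|S| = 12) (d a : nat) :
  (d, a, a) \in indep_types ->
  2 * #|pairs_of_type S d a a| = 'C(12, a) * ('C(a, d) * 'C(12 - a, a - d)).
Proof.
move=> daa; rewrite -(card_has_type hS) // card_set2_sym // => [A|A B]; last first.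
  by rewrite !(has_typeE hS) (setIC A B) (andbC (#|A| == a)).
(* Irreflexivity: a pair [(A, A)] would force [d = a], but the list contains no triple
   [(a, a, a)]. *)
rewrite (has_typeE hS) daa setIid /=; apply/negP => /and3P[/eqP-> /eqP ed _].
by move: daa; rewrite ed !inE; do 8?[case/orP]; move=> /eqP[->].
Qed.

Lemma cell_sizesE (S : finType) (hS : #|S| = 12) (d a b : nat) (A B : {set S}) :
  has_type d a b A B ->
  cell_sizes A B = [:: d; a - d; b - d; 12 - a - (b - d)].
Proof.
rewrite (has_typeE hS) => /andP[_ /and3P[/eqP ed /eqP ea /eqP eb]].
have hA := cardsID B A; have hB := cardsID A B.
have hC := cardsID B (~: A); have hT := cardsC A; rewrite hS in hT.
rewrite /cell_sizes -!setDE ed -ea -eb.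
rewrite [~: A :&: B]setIC -setDE in hC *; rewrite [B :&: A]setIC in hB.
congr [:: _; _; _; _]; lia.
Qed.

(** Reduces the cases with [a < b] to arithmetic on the listed triples; the only triple with [a = b]
    is treated separately. *)
Lemma case_spec_lt (S : finType) (hS : #|S| = 12) (ts : seq (nat * nat * nat))
    (cs : seq nat) (n : nat) :
  {subset ts <= indep_types} ->
  (forall d a b, (d, a, b) \in ts ->
    [/\ a < b, 'C(12, a) * ('C(a, d) * 'C(12 - a, b - d)) = n &
        perm_eq [:: d; a - d; b - d; 12 - a - (b - d)] cs]) ->
  case_spec S ts cs n.
Proof.
move=> sub_ts spec d a b dab; have [lt_ab cardE cellsE] := spec d a b dab.
split=> [|A B /(cell_sizesE hS) -> //].
by rewrite (card_pairs_of_type_lt hS) // sub_ts.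
Qed.

Lemma sum_case_spec (S : finType) (ts : seq (nat * nat * nat)) (cs : seq nat)
    (n : nat) :
  case_spec S ts cs n ->
  \sum_(t <- ts) #|pairs_of_type S t.1.1 t.1.2 t.2| = size ts * n.
Proof.
move=> spec; rewrite big_seq (eq_bigr (fun=> n)) => [|[[d a] b] /spec[] //].
by rewrite -big_seq big_const_seq count_predT iter_addn addn0 mulnC.
Qed.

Lemma indep_pairs_bigcup (S : finType) (hS : #|S| = 12) :
  indep_pairs S = \bigcup_(t <- indep_types) pairs_of_type S t.1.1 t.1.2 t.2.
Proof.
apply/setP => P; apply/imset2P/bigcup_seqP => [[A B _]|[t _]].
  rewrite !inE /= => iAB ->.
  (* Independence is symmetric, so the events may be named by increasing size. *)
  wlog le_AB : A B iAB / #|A| <= #|B|.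
    move=> IH; case/orP: (leq_total #|A| #|B|) => [|le_BA]; first exact: IH.
    rewrite setUC; apply: IH => //; move: iAB.
    by rewrite /indep_events /independent setIC GRing.mulrC andbCA.
  exists (#|A :&: B|, #|A|, #|B|); first by rewrite -(indep_typesP hS) iAB.
  by apply/imset2P; exists A B; rewrite ?inE //= /has_type iAB le_AB !eqxx.
case/imset2P=> A B _; rewrite !inE /= => /andP[iAB _] ->.
by exists A B; rewrite ?inE.
Qed.

Theorem mainTheorem1 (S : finType) (hS : #|S| = 12) :
  let case1 := [:: (1, 3, 4); (2, 3, 8); (3, 4, 9); (6, 8, 9)] in
  let case2 := [:: (1, 2, 6); (5, 6, 10)] in
  let case3 := [:: (2, 4, 6); (4, 6, 8)] in
  let case4 := [:: (3, 6, 6)] in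
  let n1 := 55440 in
  let n2 := 33264 in
  let n3 := 207900 in
  let n4 := 184800 in
  let K1 := #|indep_pairs S| in
  (forall d a b : nat,
     (exists A B : {set S}, has_type d a b A B) <->
     (d, a, b) \in case1 ++ case2 ++ case3 ++ case4) /\
  case_spec S case1 [:: 1; 2; 3; 6] n1 /\
  case_spec S case2 [:: 1; 1; 5; 5] n2 /\
  case_spec S case3 [:: 2; 2; 4; 4] n3 /\
  case_spec S case4 [:: 3; 3; 3; 3] n4 /\
  K1 = 4 * n1 + 2 * n2 + 2 * n3 + n4 /\
  K1 = 888888.
Proof.
move=> case1 case2 case3 case4 n1 n2 n3 n4 K1.
have spec1 : case_spec S case1 [:: 1; 2; 3; 6] n1.
  apply: case_spec_lt => //; [exact/allP | move=> d a b];
    rewrite !inE; do 3?[case/orP];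
    by move=> /eqP[-> -> ->]; split=> //; eval_bins; lia_num.
have spec2 : case_spec S case2 [:: 1; 1; 5; 5] n2.
  apply: case_spec_lt => //; [exact/allP | move=> d a b];
    rewrite !inE; do 1?[case/orP];
    by move=> /eqP[-> -> ->]; split=> //; eval_bins; lia_num.
have spec3 : case_spec S case3 [:: 2; 2; 4; 4] n3.
  apply: case_spec_lt => //; [exact/allP | move=> d a b];
    rewrite !inE; do 1?[case/orP];
    by move=> /eqP[-> -> ->]; split=> //; eval_bins; lia_num.
have spec4 : case_spec S case4 [:: 3; 3; 3; 3] n4.
  move=> d a b /[!inE] /eqP[-> -> ->]; split=> [|A B /(cell_sizesE hS) -> //].
  (* The ordered count is 924 * 20 * 20 = 369600, twice the required number. *)
  have := @card_pairs_of_type_eq S hS 3 6 isT.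
  by rewrite /n4; eval_bins; move: #|_| => k; lia_num.
have K1E : K1 = 4 * n1 + 2 * n2 + 2 * n3 + n4.
  (* Only the shape of the sum matters here; opaque counts keep the large numerals from being
     unfolded. *)
  clearbody n1 n2 n3 n4.
  rewrite /K1 (indep_pairs_bigcup hS) card_bigcup_seq => [||//]; last first.
    exact: pairs_of_type_inj.
  have -> : indep_types = case1 ++ case2 ++ case3 ++ case4 by [].
  rewrite !big_cat /= (sum_case_spec spec1) (sum_case_spec spec2).
  by rewrite (sum_case_spec spec3) (sum_case_spec spec4) mul1n !addnA.
have K1N : K1 = 888888 by rewrite K1E /n1 /n2 /n3 /n4; lia_num.
exact: (conj (exists_has_type hS) (conj spec1 (conj spec2 (conj spec3
  (conj spec4 (conj K1E K1N)))))).
Qed.
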